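(* Suppose Assumptions 1-4 listed in the context hold. Let $(x_t),(\lambda_t)$ be generated by Algorithm 1 (described in the context) with $\alpha=\sqrt{T}$ and $\sigma=1/\sqrt{T}$. Let $x^*$ be an optimal solution of $\min_{x\in\mathcal C}\sum_{t=0}^{T-1}f_t(x)$ subject to $g_t(x)\le 0$ for all $t\in[T]$. Then $$\sum_{t=0}^{T-1}[f_t(x_t)-f_t(x^* )]\le\frac{\kappa_f^2+\nu_g^2+D^2}{2}\sqrt{T}.$$ Assume further that $T$ is large enough such that $T>p\kappa_g^2$. Then, for $i=1,\ldots,p$, $$\sum_{t=0}^{T-1}g^{(i)}_t(x_t)\le[\kappa_2+2\sqrt{p}\,\kappa_g^2(\nu_g+\kappa_2)]+[(2\sqrt{p}\,\kappa_g^2+1)(\kappa_0+\kappa_1+2\kappa_3)+2\kappa_g\kappa_f]\sqrt{T},$$ where $$\kappa_0=\frac{4\kappa_fD}{\varepsilon_0},\quad \kappa_1=\frac{D^2}{\varepsilon_0},\quad \kappa_2=\frac{\nu_g^2}{\varepsilon_0}-\nu_g,\quad \kappa_3=2\nu_g+\frac{\varepsilon_0}{2}+\frac{8\nu_g^2}{\varepsilon_0}\log\frac{32\nu_g^2}{\varepsilon_0^2}.$$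
   Context: Setting. $\mathcal X$ is a finite-dimensional real Hilbert space with inner product $\langle\cdot,\cdot\rangle$ and induced norm $\|\cdot\|$; $\mathcal C\subseteq\mathcal X$ is a closed convex set. $T\ge1$ and $p\ge 1$ are integers and $[T]=\{0,1,\ldots,T-1\}$. For each $t\in[T]$ there are a loss function $f_t:\mathcal C\to\mathbb R$ and a constraint function $g_t=(g_t^{(1)},\ldots,g_t^{(p)}):\mathcal C\to\mathbb R^p$. On $\mathbb R^p$, $\|\cdot\|$ is the Euclidean norm, inequalities between vectors are componentwise, and $[a]_+=\max\{a,0\}$ is applied componentwise. $\partial h(x)$ denotes the subdifferential (set of subgradients) of a convex function $h$ at $x$. Models. For each $t\in[T]$ and each reference point $x\in\mathcal C$ there are given convex functions $F_{t,x}$ and $G^{(i)}_{t,x}$, $i=1,\ldots,p$, real-valued on $\mathcal C$ (models of $f_t$ and $g_t^{(i)}$ at $x$); write $G_{t,x}=(G^{(1)}_{t,x},\ldots,G^{(p)}_{t,x})$. Assumption 1: the set $\mathcal C$ is bounded; there is a constant $D>0$ with $\|x-y\|\le D$ for all $x,y\in\mathcal C$. Assumption 2: every $f_t$ and $g_t^{(i)}$ is continuous and convex with bounded subgradients: there are constants $\kappa_f,\kappa_g>0$ (independent of $t,i$) such that $\|u_t\|\le\kappa_f$ and $\|v_t^{(i)}\|\le\kappa_g$ for all $x\in\mathcal C$, $u_t\in\partial f_t(x)$, $v_t^{(i)}\in\partial g_t^{(i)}(x)$. Assumption 3 (Slater): there are a constant $\varepsilon_0>0$ and $\widehat x\in\mathcal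 C$ (independent of $t$) with $g_t^{(i)}(\widehat x)\le-\varepsilon_0$ for $i=1,\ldots,p$ and all $t\in[T]$. Assumption 4: for all $t\in[T]$ and $x\in\mathcal C$: (i) $F_{t,x}(y)\le f_t(y)$ for all $y\in\mathcal C$, and $F_{t,x}(x)=f_t(x)$; (ii) for each $i=1,\ldots,p$, $G^{(i)}_{t,x}(y)\le g_t^{(i)}(y)$ for all $y\in\mathcal C$, and $G^{(i)}_{t,x}(x)=g_t^{(i)}(x)$; (iii) there is a constant $\nu_g>0$ (independent of $t,x$) with $\|G_{t,x}(y)\|\le\nu_g$ for all $y\in\mathcal C$. Algorithm 1 (model-based augmented Lagrangian method, parameters $\sigma,\alpha>0$). Choose any $x_0\in\mathcal C$ and set $\lambda_0=0\in\mathbb R^p$. With $$\mathcal L_{t,\sigma}(x,\lambda)=F_{t,x_t}(x)+\frac1{2\sigma}\left[\|[\lambda+\sigma G_{t,x_t}(x)]_+\|^2-\|\lambda\|^2\right],$$ for $t=0,1,\ldots,T-1$ set $$x_{t+1}=\operatorname{argmin}_{x\in\mathcal C}\left\{\mathcal L_{t,\sigma}(x,\lambda_t)+\frac{\alpha}{2}\|x-x_t\|^2\right\},\qquad \lambda_{t+1}=[\lambda_t+\sigma G_{t,x_t}(x_{t+1})]_+.$$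
   Formalization: Assumptions 1 and 2 conflict if subgradients are tested on C only; here f, g and their models live on a common convex domain U containing C (U=C or U open), with convexity, continuity, subgradients and the inequalities F≤f, G≤g of Assumption 4 taken on U; subgradient bounds are at points of C. *)

(* Defs.v *)
(* MathComp / MathComp-Analysis *)
From HB Require Import structures.
From mathcomp Require Import all_boot all_order all_algebra sesquilinear.
From mathcomp Require Import all_classical all_reals all_analysis.
Set Implicit Arguments.
Unset Strict Implicit.
Unset Printing Implicit Defensive.
Import Order.TTheory GRing.Theory Num.Theory.
Import numFieldNormedType.Exports.
Local Open Scope classical_set_scope.
Local Open Scope ring_scope.

Definition finite_dimensional (R : realType) (X : lmodType R) : Prop :=
  exists (n : nat) (b : 'I_n -> X),
    forall x : X, exists c : 'I_n -> R, x = \sum_(i < n) c i *: b i.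

(* Together with completeness of X (part of its type), this makes X a
   finite-dimensional real Hilbert space with inner product ip. *)
Definition is_findim_hilbert (R : realType) (X : completeNormedModType R)
    (ip : {dot X for idfun}) : Prop :=
  finite_dimensional X /\ forall x : X, ip x x = `|x| ^+ 2.

(* The library norm `|v| of a row vector is the sup norm. *)
Definition enorm (R : realType) (p : nat) (v : 'rV[R]_p) : R :=
  Num.sqrt (\sum_(i < p) v 0 i ^+ 2).

Definition pospart (R : realType) (p : nat) (v : 'rV[R]_p) : 'rV[R]_p :=
  map_mx (fun a => Num.max a 0) v.

Definition is_argmin (R : realType) (X : Type) (A : set X) (h : X -> R)
    (x : X) : Prop :=
  A x /\ forall y, A y -> h x <= h y.

(* [subdifferential ip U h x] is the set of subgradients at x of h viewed as a
   function with domain U (h is a total function; its values outside U are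
   irrelevant). *)
Definition subdifferential (R : realType) (X : completeNormedModType R)
    (ip : {dot X for idfun}) (U : set X) (h : X -> R) (x : X) : set X :=
  [set u | forall y, U y -> h x + ip u (y - x) <= h y].

(* U is the domain on which the losses, the constraints and their models are
   defined, and with respect to which subgradients are taken.  The case U = C
   is that of functions defined on C only.  There the subdifferential at a
   point x of C is stable under adding vectors normal to C at x, so that for C
   bounded and X <> 0 it cannot be uniformly bounded; the case of an open
   convex U containing C (e.g. U = setT) covers functions that are finite and
   convex around C, for which uniformly bounded subgradients on C are
   meaningful. *)
Definition function_domain (R : realType) (X : completeNormedModType R)
    (C U : set X) : Prop :=
  [/\ C `<=` U, convex_set U & U = C \/ open U].

Definition bounded_diameter (R : realType) (X : completeNormedModType R)
    (C : set X) (D : R) : Prop :=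
  0 < D /\ forall x y, C x -> C y -> `|x - y| <= D.

Definition bounded_subgradients (R : realType) (X : completeNormedModType R)
    (ip : {dot X for idfun}) (C U : set X) (T p : nat)
    (f : nat -> X -> R) (g : nat -> X -> 'rV[R]_p) (kf kg : R) : Prop :=
  [/\ 0 < kf, 0 < kg,
      forall t, (t < T)%N ->
        [/\ {within U, continuous (f t)}, convex_function U (f t) &
            forall x u, C x -> subdifferential ip U (f t) x u -> `|u| <= kf] &
      forall t (i : 'I_p), (t < T)%N ->
        let gi := fun y => g t y 0 i in
        [/\ {within U, continuous gi}, convex_function U gi &
            forall x v, C x -> subdifferential ip U gi x v -> `|v| <= kg]].

Definition slater (R : realType) (X : completeNormedModType R)
    (C : set X) (T p : nat) (g : nat -> X -> 'rV[R]_p) (eps0 : R) (xhat : X) :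
    Prop :=
  [/\ 0 < eps0, C xhat &
      forall t (i : 'I_p), (t < T)%N -> g t xhat 0 i <= - eps0].

(* F t x and G t x are the models of f t and g t at the reference point x. *)
Definition convex_models (R : realType) (X : completeNormedModType R)
    (C U : set X) (T p : nat)
    (F : nat -> X -> X -> R) (G : nat -> X -> X -> 'rV[R]_p) : Prop :=
  forall t x, (t < T)%N -> C x ->
    convex_function U (F t x) /\
    forall i : 'I_p, convex_function U (fun y => G t x y 0 i).

Definition minorizing_models (R : realType) (X : completeNormedModType R)
    (C U : set X) (T p : nat)
    (f : nat -> X -> R) (g : nat -> X -> 'rV[R]_p)
    (F : nat -> X -> X -> R) (G : nat -> X -> X -> 'rV[R]_p) (nug : R) : Prop :=
  0 < nug /\
  forall t x, (t < T)%N -> C x ->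
    [/\ (forall y, U y -> F t x y <= f t y) /\ F t x x = f t x,
        forall i : 'I_p,
          (forall y, U y -> G t x y 0 i <= g t y 0 i) /\
          G t x x 0 i = g t x 0 i &
        forall y, C y -> enorm (G t x y) <= nug].

Definition aug_lagrangian (R : realType) (X : completeNormedModType R)
    (p : nat) (sigma : R) (Ft : X -> R) (Gt : X -> 'rV[R]_p)
    (x : X) (lam : 'rV[R]_p) : R :=
  Ft x + 1 / (2 * sigma) *
    (enorm (pospart (lam + sigma *: Gt x)) ^+ 2 - enorm lam ^+ 2).

(* The iterates are x 0, ..., x T and lam 0, ..., lam T. *)
Definition generated_by_algorithm (R : realType)
    (X : completeNormedModType R) (C : set X) (T p : nat)
    (F : nat -> X -> X -> R) (G : nat -> X -> X -> 'rV[R]_p)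
    (sigma alpha : R) (x : nat -> X) (lam : nat -> 'rV[R]_p) : Prop :=
  [/\ C (x 0%N), lam 0%N = 0 &
      forall t, (t < T)%N ->
        is_argmin C
          (fun y => aug_lagrangian sigma (F t (x t)) (G t (x t)) y (lam t)
                    + alpha / 2 * `|y - x t| ^+ 2)
          (x t.+1) /\
        lam t.+1 = pospart (lam t + sigma *: G t (x t) (x t.+1))].

Definition feasible_set (R : realType) (X : completeNormedModType R)
    (C : set X) (T p : nat) (g : nat -> X -> 'rV[R]_p) : set X :=
  [set x | C x /\ forall t (i : 'I_p), (t < T)%N -> g t x 0 i <= 0].

Definition kappa0 (R : realType) (kf D eps0 : R) : R := 4 * kf * D / eps0.
Definition kappa1 (R : realType) (D eps0 : R) : R := D ^+ 2 / eps0.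
Definition kappa2 (R : realType) (nug eps0 : R) : R := nug ^+ 2 / eps0 - nug.
Definition kappa3 (R : realType) (nug eps0 : R) : R :=
  2 * nug + eps0 / 2
  + 8 * nug ^+ 2 / eps0 * ln (32 * nug ^+ 2 / eps0 ^+ 2).

(* Main.v *)
(* With s = sqrt T, the step-t objective is s-strongly convex, so x_{t+1}
   satisfies a three-point inequality against every y in C.  Since a subgradient
   at x of a minorizing model is a subgradient of the modelled function, models
   lose at most kappa * |y - x|.  Comparing with y = xstar telescopes to the
   regret bound; comparing with y = xhat shows that
   |lambda_t|^2 + |xhat - x_t|^2 decreases as soon as |lambda_t| exceeds a fixed
   threshold, which bounds the multipliers; comparing with y = x_t bounds
   |x_{t+1} - x_t|.  Finally the i-th constraint value at x_t is at most
   s (lambda_{t+1} - lambda_t)_i + kappa_g |x_{t+1} - x_t|. *)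
Require Import Defs.
From HB Require Import structures.
From mathcomp Require Import all_boot all_order all_algebra sesquilinear.
From mathcomp Require Import all_classical all_reals all_analysis.
From mathcomp Require Import ring lra.
Set Implicit Arguments.
Unset Strict Implicit.
Unset Printing Implicit Defensive.
Import Order.TTheory GRing.Theory Num.Theory.
Import numFieldNormedType.Exports.
Local Open Scope classical_set_scope.
Local Open Scope ring_scope.

(** * Convexity with real weights in place of interval elements *)

Section Convexity.
Context (R : realType) (E : lmodType R).

Lemma convex_setP (A : set E) (x y : E) (t : R) :
  convex_set A -> A x -> A y -> 0 <= t <= 1 -> A (t *: x + (1 - t) *: y).
Proof.
move=> cA Ax Ay /andP[t0 t1].
have := cA x y (Itv01 t0 t1); rewrite !inE; exact.
Qed.

Lemma convex_functionP (A : set E) (h : E -> R) (x y : E) (t : R) :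
  convex_function A h -> A x -> A y -> 0 <= t <= 1 ->
  h (t *: x + (1 - t) *: y) <= t * h x + (1 - t) * h y.
Proof.
move=> cA Ax Ay /andP[t0 t1].
have := cA (Itv01 t0 t1) x y; rewrite !inE; exact.
Qed.

Lemma convex_functionI (A : set E) (h : E -> R) :
  (forall (x y : E) (t : R), A x -> A y -> 0 <= t <= 1 ->
    h (t *: x + (1 - t) *: y) <= t * h x + (1 - t) * h y) ->
  convex_function A h.
Proof.
move=> hh t x y; rewrite !inE => Ax Ay.
by apply: hh => //; rewrite ge0 le1.
Qed.

End Convexity.

(** * Inner product identities and the Cauchy-Schwarz inequality *)

Section InnerProduct.
Context (R : realType) (X : completeNormedModType R) (ip : {dot X for idfun}).
Hypothesis ipxx : forall x : X, ip x x = `|x| ^+ 2.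

Lemma ipC x y : ip x y = ip y x.
Proof. by rewrite hermC expr0 mul1r. Qed.

Lemma ipDl x y z : ip (x + y) z = ip x z + ip y z.
Proof. by rewrite linearDl. Qed.

Lemma ipDr x y z : ip z (x + y) = ip z x + ip z y.
Proof. by rewrite linearDr. Qed.

Lemma ipBr x y z : ip z (x - y) = ip z x - ip z y.
Proof. by rewrite linearBr. Qed.

Lemma ipZl a x y : ip (a *: x) y = a * ip x y.
Proof. by rewrite linearZl_LR. Qed.

Lemma ipZr a x y : ip x (a *: y) = a * ip x y.
Proof. by rewrite ipC ipZl ipC. Qed.

Lemma norm2_lincomb (a b : R) (x y : X) :
  `|a *: x + b *: y| ^+ 2
    = a ^+ 2 * `|x| ^+ 2 + 2 * a * b * ip x y + b ^+ 2 * `|y| ^+ 2.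
Proof.
rewrite -!ipxx !(ipDl, ipDr, ipZl, ipZr) (ipC y x); ring.
Qed.

(** Cauchy-Schwarz: expand the squared norm of [|y| x - |x| y], which is nonnegative, and divide by
    [|x| |y|]. *)
Lemma ip_le_norm x y : ip x y <= `|x| * `|y|.
Proof.
have [->|x0] := eqVneq x 0; first by rewrite linear0l normr0 mul0r.
have [->|y0] := eqVneq y 0; first by rewrite linear0r normr0 mulr0.
have xy0 : 0 < `|x| * `|y| by rewrite mulr_gt0 ?normr_gt0.
have := sqr_ge0 (`|(`|y| *: x + (- `|x|) *: y)|); rewrite norm2_lincomb => h.
by rewrite -(ler_pM2l xy0); nra.
Qed.

(** Strong convexity of the squared distance to [z], as an identity. Its last term produces the
    extra quadratic term of the proximal inequality. *)
Lemma norm2_conv (t : R) (x y z : X) :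
  `|t *: x + (1 - t) *: y - z| ^+ 2
    = t * `|x - z| ^+ 2 + (1 - t) * `|y - z| ^+ 2 - t * (1 - t) * `|x - y| ^+ 2.
Proof.
have -> : t *: x + (1 - t) *: y - z = t *: (x - z) + (1 - t) *: (y - z).
  by rewrite !scalerBr addrACA -opprD -scalerDl [t + _]addrC subrK scale1r.
have -> : x - y = 1 *: (x - z) + (-1) *: (y - z).
  by rewrite scale1r scaleN1r opprB addrA subrK.
by rewrite !norm2_lincomb; ring.
Qed.

End InnerProduct.

(** * Orthonormal expansion and compactness in finite dimension *)

Section Frame.
Context (R : realType) (X : completeNormedModType R) (ip : {dot X for idfun}).
Hypothesis ipxx : forall x : X, ip x x = `|x| ^+ 2.

Lemma ip_suml (I : Type) (r : seq I) (a : I -> X) (y : X) :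
  ip (\sum_(i <- r) a i) y = \sum_(i <- r) ip (a i) y.
Proof. by rewrite linear_sumlz. Qed.

Lemma ip_sumr (I : Type) (r : seq I) (a : I -> X) (y : X) :
  ip y (\sum_(i <- r) a i) = \sum_(i <- r) ip y (a i).
Proof. by rewrite ipC ip_suml; apply: eq_bigr => i _; rewrite ipC. Qed.

(* Gram-Schmidt; the elements of [e] have to be reproduced as well, so that the
   residual of the next vector is orthogonal to all of [e]. *)
Lemma frame_of_seq (s : seq X) :
  exists e : seq X, forall x, x \in s ++ e -> x = \sum_(u <- e) ip x u *: u.
Proof.
elim: s => [|a s [e he]]; first by exists [::] => x; rewrite in_nil.
pose r := a - \sum_(u <- e) ip a u *: u.
have r_orth x : x \in s ++ e -> ip x r = 0.
  move=> /he xE; rewrite ipBr [in X in X - _]xE ip_suml ip_sumr -sumrB.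
  by rewrite big1// => u _; rewrite ipZl ipZr (ipC ip u) mulrC subrr.
have [r0|r0] := eqVneq r 0.
  exists e => x; rewrite in_cons => /orP[/eqP ->|/he//].
  by apply/eqP; rewrite -subr_eq0; apply/eqP.
have nr0 : `|r| != 0 by rewrite normr_eq0.
pose r1 := `|r|^-1 *: r.
have r1_orth x : x \in s ++ e -> ip x r1 = 0.
  by move=> /r_orth; rewrite ipZr => ->; rewrite mulr0.
exists (r1 :: e) => x; rewrite big_cons => xin.
have : [|| x == a, x == r1 | x \in s ++ e].
  move: xin; rewrite !(in_cons, mem_cat).
  by case: (x == a) (x == r1) => [] [] //=; rewrite orbT.
case/or3P => [/eqP ->|/eqP ->|xin'].
- have ar : ip a r = `|r| ^+ 2.
    have {1}-> : a = r + \sum_(u <- e) ip a u *: u by rewrite subrK.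
    rewrite ipDl ip_suml ipxx big_seq big1 ?addr0// => u ue.
    by rewrite ipZl r_orth ?mulr0// mem_cat ue orbT.
  rewrite /r1 ipZr ar scalerA.
  rewrite (_ : _ * _ * _ = 1); last by field.
  by rewrite scale1r subrK.
- rewrite big_seq big1 ?addr0 => [|u ue].
    rewrite {1 2}/r1 ipZl ipZr ipxx (_ : _ * _ = 1) ?scale1r//.
    by field.
  by rewrite ipC r1_orth ?scale0r// mem_cat ue orbT.
- by rewrite r1_orth// scale0r add0r; exact: he.
Qed.

(** The reproducing identity is linear in [x], so it extends from a spanning family to the whole
    space. *)
Lemma finite_dimensional_frame :
  finite_dimensional X ->
  exists e : seq X, forall x, x = \sum_(u <- e) ip x u *: u.
Proof.
move=> [n [b bX]]; have [e he] := frame_of_seq [seq b i | i : 'I_n].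
exists e => x; have [c ->] := bX x.
rewrite [LHS](_ : _ = \sum_i c i *: \sum_(u <- e) ip (b i) u *: u).
  under eq_bigr do rewrite scaler_sumr.
  rewrite exchange_big/=; apply: eq_bigr => u _.
  by rewrite ip_suml scaler_suml; apply: eq_bigr => i _; rewrite ipZl scalerA.
apply: eq_bigr => i _; rewrite -he// mem_cat; apply/orP; left.
by apply/mapP; exists i; rewrite ?mem_enum.
Qed.

(** By Cauchy-Schwarz the frame coefficients of points of [A] lie in a compact box, so [A] is a
    closed subset of a continuous image of that box. *)
Lemma finite_dimensional_compact (A : set X) (M : R) :
  finite_dimensional X -> closed A -> (forall x, A x -> `|x| <= M) -> compact A.
Proof.
move=> /finite_dimensional_frame[e he] Acl AM.
pose Phi (c : 'rV[R]_(size e)) : X :=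
  \sum_(i < size e) c ord0 i *: (nth 0 e i : X).
pose box (i : 'I_(size e)) : set R :=
  `[- (M * `|nth 0 e i : X|), M * `|nth 0 e i : X|]%classic.
pose B := [set c : 'rV[R]_(size e) | forall i, box i (c ord0 i)].
have PhiC : continuous Phi.
  apply: continuous_big => [|i _ c]; first exact: add_continuous.
  apply: (@cvgZ _ _ _ _ (nbhs_filter c)); last exact: cvg_cst.
  exact: coord_continuous.
have BK : compact B by apply: (@rV_compact _ _ box) => i; exact: segment_compact.
have PhiBK : compact (Phi @` B).
  exact: continuous_compact (continuous_subspaceT PhiC) BK.
apply: (subclosed_compact Acl PhiBK).
move=> x Ax; exists (\row_i ip x (nth 0 e i)).
  move=> i; rewrite /box /= mxE in_itv/= -ler_norml.
  have le_M y : ip x y <= M * `|y|.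
    by rewrite (le_trans (ip_le_norm ipxx _ _))// ler_wpM2r// AM.
  rewrite ler_norml le_M andbT lerNl.
  by rewrite -(normrN (nth 0 e i)) -[- ip _ _]mulN1r -ipZr scaleN1r.
rewrite [RHS]he (big_nth 0) big_mkord /Phi.
by apply: eq_bigr => i _; rewrite mxE.
Qed.

End Frame.

(** * Sublinear functions and minorants that are linear along given vectors *)

Section Sublinear.
Context (R : realType) (E : lmodType R).

(** Only one inequality of positive homogeneity is required; equality follows by rescaling with the
    inverse factor. *)
Definition sublinear (q : E -> R) :=
  (forall x y, q (x + y) <= q x + q y) /\
  (forall (a : R) x, 0 <= a -> q (a *: x) <= a * q x).

Lemma sublinear0 q : sublinear q -> q 0 = 0.
Proof.
move=> [qD qZ]; have := qD 0 0; have := qZ 0 0 (lexx 0).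
by rewrite scale0r mul0r addr0; lra.
Qed.

Lemma sublinearN q x : sublinear q -> - q (- x) <= q x.
Proof. by move=> ql; have := ql.1 x (- x); rewrite subrr sublinear0//; lra. Qed.

Lemma sublinearZ q (a : R) x : sublinear q -> 0 <= a -> q (a *: x) = a * q x.
Proof.
move=> ql; rewrite le_eqVlt => /orP[/eqP<-|a0].
  by rewrite scale0r mul0r sublinear0.
apply/eqP; rewrite eq_le ql.2 ?(ltW a0)//=.
rewrite -ler_pdivlMl//; have := ql.2 a^-1 (a *: x).
by rewrite scalerA mulVf ?gt_eqF// scale1r; apply; rewrite invr_ge0 ltW.
Qed.

(* The infimum over [0 <= s] of [q (x + s *: e) - s * q e] is linear along [e];
   repeating this along a spanning family replaces Hahn-Banach. *)
Lemma sublinear_linear_at q (e : E) : sublinear q ->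
  exists q', [/\ sublinear q', forall x, q' x <= q x & q' e + q' (- e) <= 0].
Proof.
move=> ql.
pose S x := [set q (x + s *: e) - s * q e | s in [set s | 0 <= s]].
have S_lb x : lbound (S x) (- q (- x)).
  move=> _ [s /= s0 <-]; rewrite -(sublinearZ _ ql s0).
  by have := ql.1 (- x) (x + s *: e); rewrite addKr; lra.
have S_ne x : S x !=set0 by exists (q (x + 0 *: e) - 0 * q e); exists 0 => /=.
pose q' x := inf (S x).
have q'_le x (s : R) : 0 <= s -> q' x <= q (x + s *: e) - s * q e.
  by move=> s0; apply: ge_inf; [exists (- q (- x))|exists s].
have le_q' x (m : R) :
    (forall s : R, 0 <= s -> m <= q (x + s *: e) - s * q e) -> m <= q' x.
  by move=> h; apply: lb_le_inf => // _ [s /= s0 <-]; exact: h.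
have q'q x : q' x <= q x.
  by have := q'_le x 0 (lexx 0); rewrite scale0r mul0r addr0 subr0.
exists q'; split => //; first split.
- move=> x y; rewrite -lerBlDr; apply: (le_q') => s s0.
  rewrite lerBlDr -lerBlDl; apply: (le_q') => t t0.
  have := q'_le (x + y) (s + t) (addr_ge0 s0 t0).
  have := ql.1 (x + s *: e) (y + t *: e).
  by rewrite addrACA -scalerDl; lra.
- move=> a x; rewrite le_eqVlt => /orP[/eqP<-|a0].
    by rewrite scale0r mul0r -(sublinear0 ql).
  rewrite -ler_pdivrMl//; apply: (le_q') => s s0.
  rewrite ler_pdivrMl//.
  have := q'_le (a *: x) (a * s) (mulr_ge0 (ltW a0) s0).
  by rewrite -scalerA -scalerDr (sublinearZ _ ql (ltW a0)) mulrBr mulrA.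
- have := q'_le (- e) 1 ler01; have := q'q e.
  by rewrite scale1r addNr (sublinear0 ql); lra.
Qed.

(** Each step only lowers the function, so the inequality [q' e + q' (- e) <= 0] obtained for
    earlier vectors survives later steps. *)
Lemma sublinear_linear_at_seq q (s : seq E) : sublinear q ->
  exists q', [/\ sublinear q', forall x, q' x <= q x &
    forall e, e \in s -> q' e + q' (- e) <= 0].
Proof.
move=> ql; elim: s => [|e s [q1 [q1l q1q q1s]]]; first by exists q.
have [q2 [q2l q21 q2e]] := sublinear_linear_at e q1l.
exists q2; split => // [x|u]; first exact: le_trans (q1q _).
rewrite in_cons => /orP[/eqP ->//|/q1s].
by have := q21 u; have := q21 (- u); lra.
Qed.

Lemma sublinear_sum q (I : Type) (r : seq I) (a : I -> E) : sublinear q ->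
  q (\sum_(i <- r) a i) <= \sum_(i <- r) q (a i).
Proof.
move=> ql; elim: r => [|i r ih]; first by rewrite !big_nil sublinear0.
by rewrite !big_cons; apply: le_trans (ql.1 _ _) _; rewrite lerD2l.
Qed.

End Sublinear.

(** * Existence of subgradients on open convex domains *)

Section Subgradient.
Context (R : realType) (X : completeNormedModType R) (ip : {dot X for idfun}).
Hypothesis ipxx : forall x : X, ip x x = `|x| ^+ 2.
Hypothesis X_fin : finite_dimensional X.

(** Take a minorant [q'] linear along the frame and let [v] have coefficients [q' u]. Expanding [d]
    in the frame gives [q' d <= ip v d]; the same at [- d] gives
    [ip v d <= - q' (- d) <= q' d <= q d]. *)
Lemma sublinear_support (q : X -> R) : sublinear q ->
  exists v : X, forall d, ip v d <= q d.
Proof.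
move=> ql; have [e he] := finite_dimensional_frame ipxx X_fin.
have [q' [q'l q'q q'e]] := sublinear_linear_at_seq e ql.
pose v := \sum_(u <- e) q' u *: u.
have q'v d : q' d <= ip v d.
  rewrite {1}(he d); apply: le_trans (sublinear_sum _ _ q'l) _.
  rewrite /v ip_suml big_seq [leRHS]big_seq; apply: ler_sum => u ue.
  rewrite ipZl (ipC ip u) mulrC.
  have [c0|c0] := leP 0 (ip d u); first by rewrite sublinearZ// mulrC.
  rewrite -[X in q' (X *: _)]opprK scaleNr -scalerN.
  rewrite (sublinearZ _ q'l) ?oppr_ge0 ?(ltW c0)//.
  by have := q'e u ue; nra.
exists v => d; have := q'v (- d); rewrite linearNr => h.
by have := sublinearN d q'l; have := q'q d; lra.
Qed.

(** The directional derivative of [h] at [x] is sublinear, and any vector supporting it is a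
    subgradient. Openness of [U] allows small steps in every direction, which keeps the derivative
    finite. *)
Lemma convex_subgradient (U : set X) (h : X -> R) (x : X) :
  open U -> convex_function U h -> convex_set U -> U x ->
  subdifferential ip U h x !=set0.
Proof.
move=> Uo hcv Ucv Ux.
(* The infimum of [S d] is the directional derivative of [h] at [x] along [d]. *)
pose S d := [set (h (x + s *: d) - h x) / s |
  s in [set s | 0 < s /\ U (x + s *: d)]].
have S_dir d : exists2 s : R, 0 < s & U (x + s *: d).
  have [r /= r0 rU] : nbhs_ball x U by apply/nbhs_ballP; exact: open_nbhs_nbhs.
  exists (r / 2 / (`|d| + 1)).
    by rewrite !divr_gt0// ltr_wpDl.
  apply: rU; rewrite -ball_normE /ball_ /= opprD addNKr normrN normrZ.
  have d1 : 0 < `|d| + 1 by rewrite ltr_wpDl.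
  rewrite gtr0_norm ?divr_gt0// mulrAC ltr_pdivrMr//.
  by have := normr_ge0 d; nra.
have S_ne d : S d !=set0.
  by have [s s0 Us] := S_dir d; exists ((h (x + s *: d) - h x) / s); exists s.
(* The point reached along [d + e] with step [s t / (s + t)] is the convex combination of [x + s d]
   and [x + t e] with weights [t / (s + t)] and [s / (s + t)]. Convexity then makes the difference
   quotients subadditive. *)
have cvx (s t : R) d e : 0 < s -> 0 < t -> U (x + s *: d) -> U (x + t *: e) ->
    U (x + (s * t / (s + t)) *: (d + e)) /\
    (h (x + (s * t / (s + t)) *: (d + e)) - h x) / (s * t / (s + t))
      <= (h (x + s *: d) - h x) / s + (h (x + t *: e) - h x) / t.
  move=> s0 t0 Us Ut.
  have st0 : 0 < s + t by rewrite addr_gt0.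
  have -> : x + (s * t / (s + t)) *: (d + e) =
      (t / (s + t)) *: (x + s *: d) + (1 - t / (s + t)) *: (x + t *: e).
    rewrite !scalerDr addrACA -scalerDl [t / _ + _]addrC subrK scale1r !scalerA.
    congr (_ + (_ *: _ + _ *: _)); field; exact: lt0r_neq0.
  have t01 : 0 <= t / (s + t) <= 1.
    by rewrite divr_ge0 ?(ltW t0) ?(ltW st0)//= ler_pdivrMr// mul1r lerDr (ltW s0).
  split; first exact: convex_setP.
  rewrite ler_pdivrMr ?divr_gt0 ?mulr_gt0//.
  apply: le_trans (lerB (convex_functionP hcv Us Ut t01) (lexx _)) _.
  rewrite le_eqVlt; apply/orP; left; apply/eqP; field.
  by rewrite !lt0r_neq0.
(* Opposite directions sum to zero, so a single quotient along [- d] bounds all quotients along [d]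
   from below. *)
have S_lb d : exists m, lbound (S d) m.
  have [t t0 Ut] := S_dir (- d).
  exists (- ((h (x + t *: - d) - h x) / t)) => _ [s /= [s0 Us] <-].
  have [_] := cvx s t d (- d) s0 t0 Us Ut.
  by rewrite subrr scaler0 addr0 subrr mul0r; lra.
pose q d := inf (S d).
have q_le d (s : R) : 0 < s -> U (x + s *: d) -> q d <= (h (x + s *: d) - h x) / s.
  by move=> s0 Us; apply: ge_inf; [exact: S_lb|exists s].
have le_q d (m : R) : (forall s : R, 0 < s -> U (x + s *: d) ->
    m <= (h (x + s *: d) - h x) / s) -> m <= q d.
  by move=> hm; apply: lb_le_inf => // _ [s /= [s0 Us] <-]; exact: hm.
have ql : sublinear q.
  split=> [d e|a d].
    rewrite -lerBlDr; apply: (le_q) => s s0 Us.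
    rewrite lerBlDr -lerBlDl; apply: (le_q) => t t0 Ut.
    have [Ust hst] := cvx s t d e s0 t0 Us Ut.
    rewrite lerBlDl; apply: le_trans hst; apply: (q_le) => //.
    by rewrite divr_gt0 ?mulr_gt0// addr_gt0.
  rewrite le_eqVlt => /orP[/eqP<-|a0].
    rewrite scale0r mul0r; have := q_le 0 1 ltr01.
    by rewrite scaler0 addr0 subrr mul0r; exact.
  rewrite -ler_pdivrMl//; apply: (le_q) => s s0 Us.
  rewrite ler_pdivrMl//; have := q_le (a *: d) (s / a).
  rewrite scalerA divfK ?gt_eqF// => /(_ _ Us); rewrite divr_gt0// => /(_ isT).
  by rewrite invf_div mulrCA.
have [v hv] := sublinear_support ql.
exists v => y Uy; rewrite -lerBrDl; apply: le_trans (hv _) _.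
have := q_le (y - x) 1 ltr01; rewrite scale1r addrC subrK divr1; exact.
Qed.

End Subgradient.

(** * Lower bounds for models that touch a function from below *)

Section ModelLowerBound.
Context (R : realType) (X : completeNormedModType R) (ip : {dot X for idfun}).
Hypothesis ipxx : forall x : X, ip x x = `|x| ^+ 2.
Hypothesis X_fin : finite_dimensional X.

Lemma ip_continuous (w : X) : continuous (ip w).
Proof.
move=> z; apply/cvgrPdist_lt => e e0.
have w1 : 0 < `|w| + 1 by rewrite ltr_wpDl.
near=> y; have yz : `|z - y| < e / (`|w| + 1).
  by near: y; apply: cvgr_dist_lt; rewrite ?divr_gt0//; exact: cvg_id.
rewrite -ipBr ltr_norml ltrNl.
have ip_lt u : `|u| = `|z - y| -> ip w u < e.
  move=> uE; apply: le_lt_trans (ip_le_norm ipxx _ _) _; rewrite uE.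
  by move: yz; rewrite ltr_pdivlMr//; have := normr_ge0 (z - y); nra.
by rewrite ip_lt// -mulN1r -ipZr ip_lt// scaleN1r normrN.
Unshelve. all: by end_near. Qed.

(** A minimizer over [C] of [f - ip w] exists by compactness, and minimality there is exactly the
    subgradient inequality for [w]. *)
Lemma compact_subgradient (C : set X) (f : X -> R) (w : X) :
  compact C -> C !=set0 -> {within C, continuous f} ->
  exists2 x, C x & subdifferential ip C f x w.
Proof.
move=> Cc C0 fc.
have fwc : {within C, continuous (fun y => f y - ip w y)}.
  move=> z; apply: cvgB; first exact: fc.
  by apply: continuous_subspaceT; exact: ip_continuous.
have [c cC cmin] := compact_EVT_min C0 Cc fwc.
rewrite inE in cC; exists c => // y Cy.
by have := cmin y; rewrite inE => /(_ Cy); rewrite ipBr; lra.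
Qed.

(** A nonzero [w], rescaled to norm [|k| + 1], would be a subgradient at some point of [C] and
    violate the bound [k]. *)
Lemma bounded_subgradients_unit (C : set X) (f : X -> R) (k : R) :
  compact C -> C !=set0 -> {within C, continuous f} ->
  (forall x u, C x -> subdifferential ip C f x u -> `|u| <= k) ->
  forall x : X, x = 0.
Proof.
move=> Cc C0 fc fk w; apply/eqP; apply: contraT => w0.
have nw : 0 < `|w| by rewrite normr_gt0.
have [x Cx hx] := compact_subgradient (((`|k| + 1) / `|w|) *: w) Cc C0 fc.
have := fk _ _ Cx hx; rewrite normrZ normrM normfV normr_id divfK ?gt_eqF//.
by rewrite ger0_norm ?addr_ge0//; have := ler_norm k; lra.
Qed.

(* When [U = C], every vector is a subgradient of [f] somewhere on the compact
   set [C], so that bounded subgradients force [X] to be trivial. *)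
Lemma minorant_lower_bound (C U : set X) (f h : X -> R) (D k : R) (x y : X) :
  closed C -> bounded_diameter C D -> function_domain C U ->
  {within U, continuous f} ->
  (forall x u, C x -> subdifferential ip U f x u -> `|u| <= k) ->
  convex_function U h -> (forall z, U z -> h z <= f z) -> h x = f x ->
  C x -> C y -> f x - k * `|y - x| <= h y.
Proof.
move=> Ccl [D0 CD] [CU Ucv UC] fc fk hcv hf hx Cx Cy.
case: UC => [UC|Uo].
  subst U.
  have Cc : compact C.
    apply: (finite_dimensional_compact ipxx (M := `|x| + D) X_fin Ccl) => z Cz.
    by rewrite -(subrK x z) addrC (le_trans (ler_normD _ _))// lerD2l CD.
  have X0 := bounded_subgradients_unit Cc (ex_intro _ x Cx) fc fk.
  by rewrite (X0 (y - x)) normr0 mulr0 subr0 (X0 y) -(X0 x) hx.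
have [v hv] := convex_subgradient ipxx X_fin Uo hcv Ucv (CU _ Cx).
have vk : `|v| <= k.
  apply: (fk x) => // z Uz; rewrite -hx.
  by apply: le_trans (hv z Uz) _; exact: hf.
have := hv y (CU _ Cy); rewrite hx.
have := ip_le_norm ipxx (- v) (y - x).
rewrite -[- v]scaleN1r ipZl scaleN1r normrN.
by have := normr_ge0 (y - x); nra.
Qed.

End ModelLowerBound.

(** * Euclidean norm and componentwise positive part *)

Section EuclideanNorm.
Context (R : realType) (p : nat).
Implicit Types u v : 'rV[R]_p.

Lemma enorm_ge0 v : 0 <= enorm v.
Proof. exact: sqrtr_ge0. Qed.

Lemma enorm2 v : enorm v ^+ 2 = \sum_(i < p) v 0 i ^+ 2.
Proof. by rewrite sqr_sqrtr// sumr_ge0// => i _; exact: sqr_ge0. Qed.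

Lemma enorm0 : enorm (0 : 'rV[R]_p) = 0.
Proof.
by rewrite /enorm big1 ?sqrtr0// => i _; rewrite mxE expr0n.
Qed.

Lemma enorm_eq0 v i : enorm v = 0 -> v 0 i = 0.
Proof.
move=> v0; have := enorm2 v; rewrite v0 expr0n/= => /esym/eqP.
rewrite psumr_eq0 => [|j _]; last exact: sqr_ge0.
by move=> /allP/(_ i (mem_index_enum i)); rewrite sqrf_eq0 => /eqP.
Qed.

Lemma enorm_cauchy u v : \sum_(i < p) u 0 i * v 0 i <= enorm u * enorm v.
Proof.
have [u0|u0] := eqVneq (enorm u) 0.
  by rewrite u0 mul0r big1// => i _; rewrite enorm_eq0// mul0r.
have [v0|v0] := eqVneq (enorm v) 0.
  by rewrite v0 mulr0 big1// => i _; rewrite (enorm_eq0 _ v0) mulr0.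
have uv0 : 0 < enorm u * enorm v by rewrite mulr_gt0// lt0r ?u0 ?v0 enorm_ge0.
have : 0 <= \sum_(i < p) (enorm v * u 0 i - enorm u * v 0 i) ^+ 2.
  by apply: sumr_ge0 => i _; exact: sqr_ge0.
rewrite (eq_bigr (fun i => enorm v ^+ 2 * u 0 i ^+ 2 + enorm u ^+ 2 * v 0 i ^+ 2
  + (- (2 * enorm u * enorm v)) * (u 0 i * v 0 i))); last by move=> i _; ring.
rewrite !big_split/= -!mulr_sumr -!enorm2 => h.
by rewrite -(ler_pM2l uv0); nra.
Qed.

Lemma enormD u v : enorm (u + v) <= enorm u + enorm v.
Proof.
rewrite -(ler_pXn2r (n := 2))// ?nnegrE ?addr_ge0 ?enorm_ge0// enorm2.
rewrite (eq_bigr (fun i => u 0 i ^+ 2 + v 0 i ^+ 2 + 2 * (u 0 i * v 0 i))).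
  rewrite !big_split/= -mulr_sumr -!enorm2.
  by have := enorm_cauchy u v; lra.
by move=> i _; rewrite mxE; ring.
Qed.

Lemma enormZ (a : R) v : 0 <= a -> enorm (a *: v) = a * enorm v.
Proof.
move=> a0; apply/eqP; rewrite -(eqrXn2 (n := 2))// ?mulr_ge0 ?enorm_ge0//.
rewrite exprMn !enorm2 mulr_sumr; apply/eqP/eq_bigr => i _.
by rewrite mxE exprMn.
Qed.

Lemma coord_le_enorm v i : `|v 0 i| <= enorm v.
Proof.
rewrite -(ler_pXn2r (n := 2))// ?nnegrE ?enorm_ge0// enorm2 real_normK ?num_real//.
by rewrite (bigD1 i)//= lerDl sumr_ge0// => j _; exact: sqr_ge0.
Qed.

(** Cauchy-Schwarz against the all-ones vector; this is the source of the factor [sqrt p] in the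
    constraint bound. *)
Lemma sum_coord_le_enorm v : \sum_(i < p) v 0 i <= Num.sqrt p%:R * enorm v.
Proof.
have := enorm_cauchy (const_mx 1) v.
rewrite [enorm (const_mx 1)](_ : _ = Num.sqrt p%:R).
  by apply: le_trans; apply: ler_sum => i _; rewrite mxE mul1r.
rewrite /enorm; congr Num.sqrt.
rewrite (eq_bigr (fun=> 1)); first by rewrite sumr_const card_ord.
by move=> i _; rewrite mxE expr1n.
Qed.

(** Expanding the square of the sum leaves only nonnegative cross terms. With the Slater condition
    this turns a sum of multipliers into their Euclidean norm. *)
Lemma enorm_le_sum v : (forall i, 0 <= v 0 i) -> enorm v <= \sum_(i < p) v 0 i.
Proof.
move=> v0; have s0 : 0 <= \sum_(i < p) v 0 i by exact: sumr_ge0.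
rewrite -(ler_pXn2r (n := 2))// ?nnegrE ?enorm_ge0// enorm2 expr2 mulr_suml.
apply: ler_sum => i _; rewrite expr2 ler_wpM2l//.
by rewrite (bigD1 i)//= lerDl sumr_ge0.
Qed.

Lemma pospartE v i : pospart v 0 i = Num.max (v 0 i) 0.
Proof. by rewrite mxE. Qed.

Lemma pospart_ge0 v i : 0 <= pospart v 0 i.
Proof. by rewrite pospartE le_max lexx orbT. Qed.

Lemma enorm2_pospart_le u v :
  (forall i, pospart u 0 i ^+ 2 <= v 0 i ^+ 2) -> enorm (pospart u) <= enorm v.
Proof.
move=> h; rewrite -(ler_pXn2r (n := 2))// ?nnegrE ?enorm_ge0// !enorm2.
exact: ler_sum.
Qed.

Lemma enorm_pospart v : enorm (pospart v) <= enorm v.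
Proof.
apply: enorm2_pospart_le => i; rewrite pospartE.
by case: (leP (v 0 i) 0) => _; rewrite ?expr0n ?sqr_ge0.
Qed.

(** The squared positive part is convex and nondecreasing. Allowing [w] to lie below the convex
    combination makes the bound applicable to convex constraint models. *)
Lemma enorm2_pospart_conv (t : R) (u v w : 'rV[R]_p) : 0 <= t <= 1 ->
  (forall i, w 0 i <= t * u 0 i + (1 - t) * v 0 i) ->
  enorm (pospart w) ^+ 2
    <= t * enorm (pospart u) ^+ 2 + (1 - t) * enorm (pospart v) ^+ 2.
Proof.
move=> /andP[t0 t1] h; rewrite !enorm2 !mulr_sumr -big_split/=.
apply: ler_sum => i _; rewrite !pospartE; have := h i.
move: (u 0 i) (v 0 i) (w 0 i) => a b c hc.
have a0 : 0 <= Num.max a 0 by rewrite le_max lexx orbT.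
have b0 : 0 <= Num.max b 0 by rewrite le_max lexx orbT.
have aa : a <= Num.max a 0 by rewrite le_max lexx.
have bb : b <= Num.max b 0 by rewrite le_max lexx.
have c0 : 0 <= Num.max c 0 by rewrite le_max lexx orbT.
have cc : Num.max c 0 <= t * Num.max a 0 + (1 - t) * Num.max b 0.
  rewrite ge_max addr_ge0 ?mulr_ge0 ?subr_ge0// andbT (le_trans hc)//.
  by rewrite lerD// ler_wpM2l// subr_ge0.
move: (Num.max a 0) (Num.max b 0) (Num.max c 0) a0 b0 c0 cc => {aa bb}.
move=> a' b' c' a0 b0 c0 cc.
have : c' ^+ 2 <= (t * a' + (1 - t) * b') ^+ 2.
  by rewrite ler_sqr ?nnegrE// (le_trans c0).
have : 0 <= t * (1 - t) * (a' - b') ^+ 2.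
  by apply: mulr_ge0; [rewrite mulr_ge0 ?subr_ge0|exact: sqr_ge0].
nra.
Qed.

(** Gradient inequality at [u] for the convex function [a -> max(a, 0)^2], whose derivative is
    [2 max(a, 0)]. *)
Lemma enorm2_pospart_sub u v :
  enorm (pospart u) ^+ 2 - enorm (pospart v) ^+ 2
    <= 2 * \sum_(i < p) pospart u 0 i * (u 0 i - v 0 i).
Proof.
rewrite !enorm2 mulr_sumr -sumrB; apply: ler_sum => i _; rewrite !pospartE.
move: (u 0 i) (v 0 i) => a b.
have := sqr_ge0 (a - b); have := sqr_ge0 a; have := sqr_ge0 b.
rewrite /Num.max; case: ltP => a0; case: ltP => b0; nra.
Qed.

End EuclideanNorm.

(** * The three-point inequality of a proximal step *)

Section ProximalStep.
Context (R : realType) (X : completeNormedModType R) (ip : {dot X for idfun}).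
Hypothesis ipxx : forall x : X, ip x x = `|x| ^+ 2.

(** Compare the minimizer [x] with [t y + (1 - t) x], divide by [t], and let [t] tend to 0. *)
Lemma prox_argmin (C : set X) (phi : X -> R) (a : R) (x y z : X) :
  0 <= a -> convex_set C -> convex_function C phi ->
  is_argmin C (fun u => phi u + a / 2 * `|u - z| ^+ 2) x -> C y ->
  phi x + a / 2 * `|x - z| ^+ 2 + a / 2 * `|y - x| ^+ 2
    <= phi y + a / 2 * `|y - z| ^+ 2.
Proof.
move=> a0 Ccv phicv [Cx xmin] Cy.
set A := phi x + _; set B := a / 2 * `|y - x| ^+ 2; set E := leRHS.
have B0 : 0 <= B by rewrite mulr_ge0 ?sqr_ge0// divr_ge0.
have key (t : R) : 0 < t -> t <= 1 -> A + (1 - t) * B <= E.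
  move=> t0 t1; have t01 : 0 <= t <= 1 by rewrite (ltW t0) t1.
  have := xmin _ (convex_setP Ccv Cy Cx t01).
  rewrite (norm2_conv ipxx) => h.
  have := convex_functionP phicv Cy Cx t01 => h'.
  by rewrite -(ler_pM2l t0) /A /B /E; nra.
apply/ler_addgt0Pr => e e0.
(* This choice gives [0 < t <= 1] and [t B <= e], which replaces the limit in [t]. *)
pose t : R := e / (e + B).
have eB : 0 < e + B by rewrite ltr_wpDr.
have t0 : 0 < t by rewrite divr_gt0.
have t1 : t <= 1 by rewrite ler_pdivrMr// mul1r lerDl.
have := key t t0 t1.
have tB : t * B <= e.
  by rewrite /t mulrAC ler_pdivrMr// ler_wpM2l ?(ltW e0)// lerDr ltW.
nra.
Qed.

Lemma aug_lagrangian_convex (p : nat) (C : set X) (sigma : R) (Ft : X -> R)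
    (Gt : X -> 'rV[R]_p) (lam : 'rV[R]_p) :
  0 < sigma -> convex_function C Ft ->
  (forall i, convex_function C (fun y => Gt y 0 i)) ->
  convex_function C (fun y => aug_lagrangian sigma Ft Gt y lam).
Proof.
move=> s0 Fcv Gcv; apply: convex_functionI => x y t Cx Cy t01.
rewrite /aug_lagrangian.
have := convex_functionP Fcv Cx Cy t01.
have := @enorm2_pospart_conv R p t (lam + sigma *: Gt x) (lam + sigma *: Gt y)
  (lam + sigma *: Gt (t *: x + (1 - t) *: y)) t01.
have Gh i : (lam + sigma *: Gt (t *: x + (1 - t) *: y)) 0 i <=
  t * (lam + sigma *: Gt x) 0 i + (1 - t) * (lam + sigma *: Gt y) 0 i.
  by have := convex_functionP (Gcv i) Cx Cy t01; rewrite !mxE; nra.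
move=> /(_ Gh) h1 h2.
have s1 : 0 < 1 / (2 * sigma) by rewrite divr_gt0// mulr_gt0.
nra.
Qed.

(** The three-point inequality for the augmented Lagrangian; the terms in [enorm lam ^+ 2] cancel
    between the two sides. *)
Lemma aug_lagrangian_step (p : nat) (C U : set X) (sigma alpha : R) (Ft : X -> R)
    (Gt : X -> 'rV[R]_p) (lam : 'rV[R]_p) (x y z : X) :
  0 < sigma -> 0 <= alpha -> convex_set C -> C `<=` U -> convex_function U Ft ->
  (forall i, convex_function U (fun y => Gt y 0 i)) ->
  is_argmin C (fun u => aug_lagrangian sigma Ft Gt u lam
    + alpha / 2 * `|u - z| ^+ 2) x -> C y ->
  Ft x + 1 / (2 * sigma) * enorm (pospart (lam + sigma *: Gt x)) ^+ 2
    + alpha / 2 * `|x - z| ^+ 2 + alpha / 2 * `|y - x| ^+ 2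
  <= Ft y + 1 / (2 * sigma) * enorm (pospart (lam + sigma *: Gt y)) ^+ 2
    + alpha / 2 * `|y - z| ^+ 2.
Proof.
move=> s0 a0 Ccv CU Fcv Gcv xmin Cy.
have subU (h : X -> R) : convex_function U h -> convex_function C h.
  move=> hcv t u v; rewrite !inE => Cu Cv.
  by apply: hcv; rewrite inE; exact: CU.
have Lcv := aug_lagrangian_convex lam s0 (subU _ Fcv) (fun i => subU _ (Gcv i)).
have := prox_argmin a0 Ccv Lcv xmin Cy.
by rewrite /aug_lagrangian; lra.
Qed.

End ProximalStep.

(** * Telescoping and drift estimates for real sequences *)

Section RealSequences.
Context (R : realType).

Lemma sum_le_telescope (a u : nat -> R) (c : R) (n : nat) :
  (forall t, (t < n)%N -> a t <= c + (u t - u t.+1)) ->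
  \sum_(t < n) a t <= n%:R * c + (u 0%N - u n).
Proof.
elim: n => [|n ih] h; first by rewrite big_ord0 mul0r subrr addr0.
rewrite big_ord_recr/= -natr1.
have := ih (fun t tn => h t (ltnW tn)); have := h n (ltnSn n); lra.
Qed.

(* Lyapunov function [L t ^+ 2 + a t]: it decreases once [L t] exceeds [B], and
   below that threshold one step cannot take it above [(B + m) ^+ 2 + D ^+ 2]. *)
Lemma drift_bound (L a : nat -> R) (T : nat) (B D m c : R) :
  0 <= B -> 0 <= D -> 0 <= m -> 0 <= c -> L 0%N = 0 -> (forall t, 0 <= L t) ->
  (forall t, (t <= T)%N -> 0 <= a t <= D ^+ 2) ->
  (forall t, (t < T)%N -> L t.+1 <= L t + m) ->
  (forall t, (t < T)%N ->
     L t.+1 ^+ 2 + a t.+1 <= L t ^+ 2 + a t + c * (B - L t)) ->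
  forall t, (t <= T)%N -> L t <= B + m + D.
Proof.
move=> B0 D0 m0 c0 L0 Lge0 aD Lm drift.
have V t : (t <= T)%N -> L t ^+ 2 + a t <= (B + m) ^+ 2 + D ^+ 2.
  elim: t => [_|t ih tT].
    by have := aD 0%N (leq0n _); rewrite L0 expr0n/=; have := sqr_ge0 (B + m); lra.
  have [LB|LB] := leP (L t) B.
    have /andP[_ aD1] := aD _ tT.
    rewrite lerD// ler_sqr ?nnegrE ?addr_ge0//.
    by rewrite (le_trans (Lm _ tT))// lerD2r.
  by have := drift _ tT; have := ih (ltnW tT); nra.
(* Dropping [a t >= 0], the claim follows from [(B + m)^2 + D^2 <= (B + m + D)^2]. *)
move=> t tT; have := V t tT; have := aD t tT; have := Lge0 t => Lt /andP[at0 _] h.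
rewrite -ler_sqr ?nnegrE ?addr_ge0//; nra.
Qed.

End RealSequences.

(** * Estimates along the iterates, with [sigma = 1 / s] and [alpha = s] *)

Section Algorithm.
Context (R : realType) (X : completeNormedModType R) (ip : {dot X for idfun}).
Hypothesis ipxx : forall x : X, ip x x = `|x| ^+ 2.
Hypothesis X_fin : finite_dimensional X.
Context (C U : set X) (T p : nat) (f : nat -> X -> R) (g : nat -> X -> 'rV[R]_p)
  (F : nat -> X -> X -> R) (G : nat -> X -> X -> 'rV[R]_p)
  (D kf kg eps0 nug s : R) (xhat : X) (x : nat -> X) (lam : nat -> 'rV[R]_p).
Hypothesis C_closed : closed C.
Hypothesis C_convex : convex_set C.
Hypothesis U_dom : function_domain C U.
Hypothesis FG_convex : convex_models C U T F G.
Hypothesis A1 : bounded_diameter C D.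
Hypothesis A2 : bounded_subgradients ip C U T f g kf kg.
Hypothesis A3 : slater C T g eps0 xhat.
Hypothesis A4 : minorizing_models C U T f g F G nug.
Hypothesis s_gt0 : 0 < s.
Hypothesis generated : generated_by_algorithm C T F G (1 / s) s x lam.

Let CU : C `<=` U. Proof. by have [] := U_dom. Qed.

Lemma iterate_in t : (t <= T)%N -> C (x t).
Proof.
have [C0 _ h] := generated.
by case: t => // t tT; have [[]] := h _ tT.
Qed.

Lemma multiplier_ge0 t i : (t <= T)%N -> 0 <= lam t 0 i.
Proof.
have [_ l0 h] := generated.
case: t => [_|t tT]; first by rewrite l0 mxE.
by have [_ ->] := h _ tT; exact: pospart_ge0.
Qed.

Lemma model_loss_lower t z y : (t < T)%N -> C z -> C y ->
  f t z - kf * `|y - z| <= F t z y.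
Proof.
move=> tT Cz Cy; have [_ _ /(_ t tT)[fc _ fk] _] := A2.
have [Fcv _] := FG_convex tT Cz; have [_ /(_ t z tT Cz)[[Ff Fz] _ _]] := A4.
exact: (minorant_lower_bound ipxx X_fin C_closed A1 U_dom fc fk Fcv Ff Fz Cz Cy).
Qed.

Lemma model_constraint_lower t z y i : (t < T)%N -> C z -> C y ->
  g t z 0 i - kg * `|y - z| <= G t z y 0 i.
Proof.
move=> tT Cz Cy; have [_ _ _ /(_ t i tT)[gc _ gk]] := A2.
have [_ /(_ i) Gcv] := FG_convex tT Cz.
have [_ /(_ t z tT Cz)[_ /(_ i)[Gg Gz] _]] := A4.
exact: (minorant_lower_bound ipxx X_fin C_closed A1 U_dom gc gk Gcv Gg Gz Cz Cy).
Qed.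

(** The basic inequality, used below with three choices of [y]. The penalty weight [1 / (2 sigma)]
    equals [s / 2], and the model value at the new iterate is bounded below through the subgradient
    bound [kf]. *)
Lemma step_ineq t y : (t < T)%N -> C y ->
  f t (x t) - kf * `|x t.+1 - x t| + s / 2 * enorm (lam t.+1) ^+ 2
    + s / 2 * `|x t.+1 - x t| ^+ 2 + s / 2 * `|y - x t.+1| ^+ 2
  <= F t (x t) y + s / 2 * enorm (pospart (lam t + (1 / s) *: G t (x t) y)) ^+ 2
    + s / 2 * `|y - x t| ^+ 2.
Proof.
move=> tT Cy; have [_ _ /(_ t tT)[xmin ->]] := generated.
have Cx := iterate_in (ltnW tT); have Cx1 := iterate_in tT.
have [Fcv Gcv] := FG_convex tT Cx.
have sV : 0 < 1 / s by rewrite divr_gt0.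
have := aug_lagrangian_step ipxx sV (ltW s_gt0) C_convex CU Fcv Gcv xmin Cy.
rewrite (_ : 1 / (2 * (1 / s)) = s / 2); last by field; exact: lt0r_neq0.
have := model_loss_lower tT Cx Cx1; lra.
Qed.

Lemma regret_bound (y : X) : feasible_set C T g y -> s ^+ 2 = T%:R ->
  \sum_(t < T) (f t (x t) - f t y) <= (kf ^+ 2 + D ^+ 2) / 2 * s.
Proof.
move=> [Cy gy] sT.
pose u t := s / 2 * (enorm (lam t) ^+ 2 + `|y - x t| ^+ 2).
have := @sum_le_telescope R (fun t => f t (x t) - f t y) u (kf ^+ 2 / (2 * s)) T.
have -> : T%:R * (kf ^+ 2 / (2 * s)) = kf ^+ 2 / 2 * s.
  by rewrite -sT; field; exact: lt0r_neq0.
have [_ l0 _] := generated.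
move=> h; apply: le_trans (h _) _ => {h}.
  move=> t tT; have := step_ineq tT Cy; rewrite /u.
  have [_ /(_ t (x t) tT (iterate_in (ltnW tT)))[[Ff _] Gg _]] := A4.
  have := Ff _ (CU Cy).
  (* At a feasible [y] the models satisfy [G <= g <= 0], so adding them to the nonnegative
     multiplier and truncating cannot increase any component. *)
  have : enorm (pospart (lam t + (1 / s) *: G t (x t) y)) <= enorm (lam t).
    apply: enorm2_pospart_le => i; rewrite pospartE !mxE.
    have li := multiplier_ge0 i (ltnW tT).
    rewrite ler_sqr ?nnegrE ?le_max ?lexx ?orbT// ge_max li andbT gerDl.
    rewrite mulr_ge0_le0 ?divr_ge0 ?(ltW s_gt0)//.
    by apply: le_trans (gy t i tT); have [+ _] := Gg i; apply; exact: CU.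
  move: (enorm_ge0 (pospart (lam t + (1 / s) *: G t (x t) y))) => e0 ele.
  have : enorm (pospart (lam t + (1 / s) *: G t (x t) y)) ^+ 2 <= enorm (lam t) ^+ 2.
    by rewrite ler_sqr ?nnegrE// (le_trans e0).
  (* Completing the square. Summed over [T = s^2] rounds, this error contributes [kf^2 s / 2]. *)
  have : kf * `|x t.+1 - x t| - s / 2 * `|x t.+1 - x t| ^+ 2 <= kf ^+ 2 / (2 * s).
    rewrite ler_pdivlMr ?mulr_gt0//.
    by have := sqr_ge0 (kf - s * `|x t.+1 - x t|); lra.
  by move: s_gt0; nra.
rewrite /u l0 enorm0 expr0n/= add0r.
have : `|y - x 0%N| ^+ 2 <= D ^+ 2.
  have [D0 CD] := A1.
  by rewrite ler_sqr ?nnegrE ?(ltW D0)//; apply: CD => //; exact: iterate_in.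
have := sqr_ge0 (enorm (lam T)); have := sqr_ge0 `|y - x T|; move: s_gt0; nra.
Qed.

Lemma multiplier_step t : (t < T)%N ->
  enorm (lam t.+1) <= enorm (lam t) + nug / s.
Proof.
move=> tT; have [_ _ /(_ t tT)[_ ->]] := generated.
have [_ /(_ t (x t) tT (iterate_in (ltnW tT)))[_ _ Gn]] := A4.
apply: le_trans (enorm_pospart _) _; apply: le_trans (enormD _ _) _.
rewrite lerD2l enormZ ?divr_ge0 ?(ltW s_gt0)// div1r mulrC ler_pM2r ?invr_gt0//.
by apply: Gn; exact: iterate_in.
Qed.

(** An instance of [drift_bound] with increment [nug / s] and rate [2 eps0 / s], obtained by
    comparing each step with the Slater point. *)
Lemma multiplier_bound t : (t <= T)%N ->
  enorm (lam t)
    <= (2 * kf * D + nug ^+ 2 / (2 * s)) / eps0 + nug / s + D.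
Proof.
have [kf0 kg0 _ _] := A2; have [D0 CD] := A1; have [e0 Cxh gxh] := A3.
have [nu0 A4'] := A4; have [_ l0 _] := generated.
set B := _ / eps0.
have B0 : 0 <= B.
  rewrite divr_ge0 ?(ltW e0)// addr_ge0//.
    by rewrite !mulr_ge0 ?(ltW kf0) ?(ltW D0).
  by rewrite divr_ge0 ?sqr_ge0// mulr_ge0 ?(ltW s_gt0).
have ns0 : 0 <= nug / s by rewrite divr_ge0 ?(ltW nu0) ?(ltW s_gt0).
have es0 : 0 <= 2 * eps0 / s by rewrite divr_ge0 ?mulr_ge0 ?(ltW e0) ?(ltW s_gt0).
apply: (@drift_bound R (fun t => enorm (lam t)) (fun t => `|xhat - x t| ^+ 2)
  T B D (nug / s) (2 * eps0 / s)) => //; first exact: ltW.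
- by rewrite l0 enorm0.
- by move=> u; exact: enorm_ge0.
- move=> u uT; rewrite sqr_ge0/= ler_sqr ?nnegrE ?(ltW D0)//.
  by apply: CD => //; exact: iterate_in.
- exact: multiplier_step.
move=> u uT.
have Cx := iterate_in (ltnW uT); have Cx1 := iterate_in uT.
have [[Ff _] Gg Gn] := A4' _ _ uT Cx.
have := step_ineq uT Cxh; have := Ff _ (CU Cxh).
(* The loss serves as its own minorant touching at [xhat]. Together with [dl] this accounts for the
   term [2 kf D]. *)
have fl : f u xhat - f u (x u) <= kf * D.
  have [_ _ /(_ u uT)[fc fcv fk] _] := A2.
  have := minorant_lower_bound ipxx X_fin C_closed A1 U_dom fc fk fcv
    (fun z _ => lexx (f u z)) erefl Cxh Cx.
  have : kf * `|x u - xhat| <= kf * D by rewrite ler_pM2l//; exact: CD.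
  lra.
have dl : kf * `|x u.+1 - x u| <= kf * D by rewrite ler_pM2l//; exact: CD.
have pl : enorm (pospart (lam u + (1 / s) *: G u (x u) xhat)) ^+ 2
    <= enorm (lam u) ^+ 2 - 2 * eps0 / s * enorm (lam u) + nug ^+ 2 / s ^+ 2.
  have G2 : enorm (G u (x u) xhat) ^+ 2 <= nug ^+ 2.
    by rewrite ler_sqr ?nnegrE ?enorm_ge0 ?(ltW nu0)//; exact: Gn.
  apply: (@le_trans _ _ (enorm (lam u + (1 / s) *: G u (x u) xhat) ^+ 2)).
    by rewrite ler_sqr ?nnegrE ?enorm_ge0//; exact: enorm_pospart.
  (* The cross term of the expanded square: the Slater condition makes each model value at most
     [- eps0], and the sum of the multipliers dominates their norm. *)
  have lG : \sum_(i < p) lam u 0 i * G u (x u) xhat 0 i <= - eps0 * enorm (lam u).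
    apply: (@le_trans _ _ (- eps0 * \sum_(i < p) lam u 0 i)).
      rewrite mulr_sumr; apply: ler_sum => i _; rewrite mulrC.
      rewrite ler_wpM2r ?multiplier_ge0 ?(ltnW uT)//.
      by apply: le_trans (gxh u i uT); have [+ _] := Gg i; apply; exact: CU.
    rewrite !mulNr lerN2 ler_pM2l//; apply: enorm_le_sum => i.
    by apply: multiplier_ge0; exact: ltnW.
  rewrite enorm2 (eq_bigr (fun i => lam u 0 i ^+ 2
    + 2 / s * (lam u 0 i * G u (x u) xhat 0 i)
    + (s ^+ 2)^-1 * G u (x u) xhat 0 i ^+ 2)); last first.
    by move=> i _; rewrite !mxE; field; exact: lt0r_neq0.
  rewrite !big_split/= -!mulr_sumr -!enorm2.
  have : 2 / s * \sum_(i < p) lam u 0 i * G u (x u) xhat 0 i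
    <= 2 / s * (- eps0 * enorm (lam u)) by rewrite ler_pM2l ?divr_gt0.
  have : (s ^+ 2)^-1 * enorm (G u (x u) xhat) ^+ 2 <= (s ^+ 2)^-1 * nug ^+ 2.
    by rewrite ler_pM2l ?invr_gt0 ?exprn_gt0.
  lra.
have : s / 2 * enorm (pospart (lam u + (1 / s) *: G u (x u) xhat)) ^+ 2
  <= s / 2 * (enorm (lam u) ^+ 2 - 2 * eps0 / s * enorm (lam u) + nug ^+ 2 / s ^+ 2).
  by rewrite ler_pM2l ?divr_gt0.
have -> : s / 2 * (enorm (lam u) ^+ 2 - 2 * eps0 / s * enorm (lam u)
    + nug ^+ 2 / s ^+ 2)
  = s / 2 * enorm (lam u) ^+ 2 - eps0 * enorm (lam u) + nug ^+ 2 / (2 * s).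
  by field; exact: lt0r_neq0.
have -> : 2 * eps0 / s * (B - enorm (lam u)) =
   2 / s * (2 * kf * D + nug ^+ 2 / (2 * s) - eps0 * enorm (lam u)).
  by rewrite /B; field; rewrite !lt0r_neq0.
have s2 : 0 <= s / 2 * `|x u.+1 - x u| ^+ 2.
  by rewrite mulr_ge0 ?sqr_ge0// divr_ge0// ltW.
move=> h1 h2 h3.
(* Scaling the drift inequality by [s / 2] brings it to the form of [step_ineq]. *)
rewrite -lerBlDl -(ler_pM2l (divr_gt0 s_gt0 (ltr0n _ 2))).
have -> : s / 2 * (2 / s * (2 * kf * D + nug ^+ 2 / (2 * s) - eps0 * enorm (lam u)))
  = 2 * kf * D + nug ^+ 2 / (2 * s) - eps0 * enorm (lam u).
  by field; exact: lt0r_neq0.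
lra.
Qed.

(** With [y = x t] the losses cancel, leaving [s d^2 <= kf d + s / 2 (P^2 - Q^2)]. The difference of
    squares is itself linear in [d], so one factor [d] can be divided out. *)
Lemma iterate_step t (M : R) : (t < T)%N -> enorm (lam t) <= M ->
  s * `|x t.+1 - x t| <= kf + Num.sqrt p%:R * kg * (M + nug / s).
Proof.
move=> tT lM; have [kf0 kg0 _ _] := A2; have [nu0 A4'] := A4.
have Cx := iterate_in (ltnW tT); have Cx1 := iterate_in tT.
have [[_ Fx] Gg Gn] := A4' _ _ tT Cx.
have [_ _ /(_ t tT)[_ lamE]] := generated.
set d := `|x t.+1 - x t|; set r := kf + _.
have d0 : 0 <= d by exact: normr_ge0.
have M0 : 0 <= M := le_trans (enorm_ge0 _) lM.
have r0 : 0 <= r.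
  rewrite addr_ge0 ?(ltW kf0)// mulr_ge0 ?mulr_ge0 ?sqrtr_ge0 ?(ltW kg0)//.
  by rewrite addr_ge0// divr_ge0 ?(ltW nu0) ?(ltW s_gt0).
have := step_ineq tT Cx; rewrite Fx subrr normr0 expr0n/= (distrC (x t)) -/d lamE.
set a := lam t + _ *: G t (x t) (x t).
have := enorm2_pospart_sub a (lam t + (1 / s) *: G t (x t) (x t.+1)).
(* Each component difference is [(g(x_t) - G(x_{t+1})) / s], at most [kg d / s]; the weights
   [pospart a] sum to at most [sqrt p] times their norm. *)
have : \sum_(i < p) pospart a 0 i
      * (a 0 i - (lam t + (1 / s) *: G t (x t) (x t.+1)) 0 i)
    <= kg * d / s * (Num.sqrt p%:R * (M + nug / s)).
  apply: (@le_trans _ _ (kg * d / s * \sum_(i < p) pospart a 0 i)).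
    rewrite mulr_sumr; apply: ler_sum => i _; rewrite mulrC ler_wpM2r ?pospart_ge0//.
    rewrite !mxE; have [_ ->] := Gg i.
    have := model_constraint_lower i tT Cx Cx1; rewrite -/d => h.
    rewrite opprD addrACA subrr add0r -mulrBr div1r mulrC ler_pM2r ?invr_gt0//; lra.
  rewrite ler_wpM2l ?divr_ge0 ?mulr_ge0 ?(ltW kg0) ?(ltW s_gt0)//.
  apply: le_trans (sum_coord_le_enorm _) _; rewrite ler_wpM2l ?sqrtr_ge0//.
  apply: le_trans (enorm_pospart _) _; apply: le_trans (enormD _ _) _.
  rewrite lerD// enormZ ?divr_ge0 ?(ltW s_gt0)// div1r mulrC ler_pM2r ?invr_gt0//.
  by apply: Gn.
set S := (\sum_(i < p) _); set P := enorm (pospart a); set Q := enorm (pospart _).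
move=> h1 h2 h3.
have h4 : s / 2 * (P ^+ 2 - Q ^+ 2) <= d * (Num.sqrt p%:R * kg * (M + nug / s)).
  have : s / 2 * (P ^+ 2 - Q ^+ 2) <=
     s / 2 * (2 * (kg * d / s * (Num.sqrt p%:R * (M + nug / s)))).
    by rewrite ler_pM2l ?divr_gt0//; lra.
  by move/le_trans; apply; rewrite le_eqVlt; apply/orP; left; apply/eqP; field;
    exact: lt0r_neq0.
have [d_eq0|dn0] := eqVneq d 0; first by rewrite d_eq0 mulr0.
have dp : 0 < d by rewrite lt0r dn0.
by rewrite -(ler_pM2l dp) /r; lra.
Qed.

(** The multiplier update gives [G <= s (lam_{t+1} - lam_t)] in component [i], which telescopes to
    [s lam_T]. Each round adds an error of at most [kg r / s], and [T = s^2] such errors sum to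
    [s kg r]. *)
Lemma constraint_sum_bound (M : R) (i : 'I_p) :
  s ^+ 2 = T%:R -> (forall t, (t <= T)%N -> enorm (lam t) <= M) ->
  \sum_(t < T) g t (x t) 0 i
    <= s * M + s * (kg * (kf + Num.sqrt p%:R * kg * (M + nug / s))).
Proof.
move=> sT lM; have [_ kg0 _ _] := A2; have [_ l0 gen] := generated.
set r := kf + _.
have := @sum_le_telescope R (fun t => g t (x t) 0 i) (fun t => - (s * lam t 0 i))
  (kg * r / s) T.
have -> : T%:R * (kg * r / s) = s * (kg * r).
  by rewrite -sT; field; exact: lt0r_neq0.
move=> h; apply: le_trans (h _) _ => {h}.
  move=> t tT; have Cx := iterate_in (ltnW tT); have Cx1 := iterate_in tT.
  have := model_constraint_lower i tT Cx Cx1.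
  have : kg * `|x t.+1 - x t| <= kg * r / s.
    rewrite -mulrA ler_pM2l// ler_pdivlMr// mulrC; apply: iterate_step => //.
    by apply: lM; exact: ltnW.
  have : G t (x t) (x t.+1) 0 i <= s * lam t.+1 0 i - s * lam t 0 i.
    have [_ ->] := gen _ tT; rewrite pospartE !mxE.
    rewrite -mulrBr mulrC -ler_pdivrMr// lerBrDl le_max; apply/orP; left.
    by rewrite div1r mulrC.
  lra.
rewrite l0 mxE mulr0 oppr0 sub0r opprK addrC lerD2r ler_pM2l//.
apply: le_trans (lM _ (leqnn T)); apply: le_trans (coord_le_enorm _ i).
exact: ler_norm.
Qed.

(** At [xhat] a component of the model in round 0 is at most [- eps0], while its absolute value is
    at most [nug]. This fixes the signs of [kappa2] and of the logarithm in [kappa3]. *)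
Lemma slater_le_model (i : 'I_p) : (0 < T)%N -> eps0 <= nug.
Proof.
move=> T0; have [_ Cxh gxh] := A3; have [_ /(_ 0%N (x 0%N) T0)] := A4.
move=> /(_ (iterate_in (leq0n _)))[_ /(_ i)[Gg _] Gn].
apply: le_trans (Gn xhat Cxh); apply: le_trans (coord_le_enorm _ i).
apply: le_trans (_ : - g 0%N xhat 0 i <= _); first by rewrite lerNr; exact: gxh.
by rewrite -normrN (le_trans _ (ler_norm _))// lerN2; apply: Gg; exact: CU.
Qed.

End Algorithm.

(** * Comparison with the constants of the statement *)

Section Constants.
Context (R : realType) (kf D eps0 nug s : R).
Hypotheses (kf0 : 0 < kf) (D0 : 0 < D) (e0 : 0 < eps0) (en : eps0 <= nug).

Lemma kappa2_ge0 : 0 <= kappa2 nug eps0.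
Proof.
have n0 := lt_le_trans e0 en.
by rewrite /kappa2 subr_ge0 ler_pdivlMr// expr2 ler_pM2l.
Qed.

(** From [eps0 <= nug] the argument of the logarithm is at least 1, so the logarithmic term is
    nonnegative. *)
Lemma kappa3_ge : 2 * nug + eps0 / 2 <= kappa3 nug eps0.
Proof.
have n0 := lt_le_trans e0 en.
rewrite /kappa3 lerDl mulr_ge0//.
  by rewrite divr_ge0 ?(ltW e0)// mulr_ge0 ?sqr_ge0.
rewrite ln_ge0// ler_pdivlMr ?exprn_gt0//.
have : eps0 ^+ 2 <= nug ^+ 2 by rewrite ler_sqr ?nnegrE ?(ltW e0) ?(ltW n0).
by have := sqr_ge0 nug; lra.
Qed.

(** The loss term is absorbed by [kappa0], the term [s D] by [kappa1] plus the [eps0] contained in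
    [2 kappa3], and the terms in [nug] by [kappa2] plus the [4 nug] contained in [2 kappa3], using
    [nug <= nug s]. *)
Lemma multiplier_bound_kappa : 1 <= s ->
  s * ((2 * kf * D + nug ^+ 2 / (2 * s)) / eps0 + nug / s + D)
    <= kappa2 nug eps0
       + (kappa0 kf D eps0 + kappa1 D eps0 + 2 * kappa3 nug eps0) * s.
Proof.
move=> s1; have n0 := lt_le_trans e0 en; have s0 : 0 < s by apply: lt_le_trans s1.
have -> : s * ((2 * kf * D + nug ^+ 2 / (2 * s)) / eps0 + nug / s + D) =
  s * (2 * (kf * D / eps0)) + nug ^+ 2 / eps0 / 2 + nug + s * D.
  by field; rewrite !lt0r_neq0.
have k0 : kappa0 kf D eps0 = 4 * (kf * D / eps0).
  by rewrite /kappa0; field; exact: lt0r_neq0.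
have kfD : 0 <= s * (kf * D / eps0).
  by rewrite mulr_ge0 ?(ltW s0)// divr_ge0 ?mulr_ge0 ?(ltW kf0) ?(ltW D0) ?(ltW e0).
have k1 : D - eps0 <= kappa1 D eps0.
  by rewrite /kappa1 ler_pdivlMr//; have := sqr_ge0 (D - eps0); nra.
have k1s : (D - eps0) * s <= kappa1 D eps0 * s by rewrite ler_pM2r.
have k3s : (2 * nug + eps0 / 2) * s <= kappa3 nug eps0 * s.
  by rewrite ler_pM2r// kappa3_ge.
have ns : nug <= nug * s by rewrite ler_peMr// ltW.
have nne : 0 <= nug ^+ 2 / eps0 by rewrite divr_ge0 ?sqr_ge0 ?(ltW e0).
rewrite k0 /kappa2; lra.
Qed.

End Constants.

(** * Both bounds at [s = sqrt T] *)

Theorem theorem1 (R : realType) (X : completeNormedModType R)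
    (ip : {dot X for idfun}) (hX : is_findim_hilbert ip)
    (C U : set X) (C_closed : closed C) (C_convex : convex_set C)
    (U_dom : function_domain C U)
    (T p : nat) (T_ge1 : (1 <= T)%N) (p_ge1 : (1 <= p)%N)
    (f : nat -> X -> R) (g : nat -> X -> 'rV[R]_p)
    (F : nat -> X -> X -> R) (G : nat -> X -> X -> 'rV[R]_p)
    (FG_convex : convex_models C U T F G)
    (D kf kg eps0 nug : R) (xhat : X)
    (A1 : bounded_diameter C D)
    (A2 : bounded_subgradients ip C U T f g kf kg)
    (A3 : slater C T g eps0 xhat)
    (A4 : minorizing_models C U T f g F G nug)
    (x : nat -> X) (lam : nat -> 'rV[R]_p)
    (x_lam_gen : generated_by_algorithm C T F G
       (1 / Num.sqrt T%:R) (Num.sqrt T%:R) x lam)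
    (xstar : X)
    (xstar_opt : is_argmin (feasible_set C T g)
       (fun y => \sum_(t < T) f t y) xstar) :
  \sum_(t < T) (f t (x t) - f t xstar)
    <= (kf ^+ 2 + nug ^+ 2 + D ^+ 2) / 2 * Num.sqrt T%:R
  /\
  (p%:R * kg ^+ 2 < T%:R ->
   forall i : 'I_p,
     \sum_(t < T) g t (x t) 0 i
       <= (kappa2 nug eps0
           + 2 * Num.sqrt p%:R * kg ^+ 2 * (nug + kappa2 nug eps0))
          + ((2 * Num.sqrt p%:R * kg ^+ 2 + 1)
               * (kappa0 kf D eps0 + kappa1 D eps0 + 2 * kappa3 nug eps0)
             + 2 * kg * kf) * Num.sqrt T%:R).
Proof.
have [X_fin ipxx] := hX.
set s : R := Num.sqrt T%:R.
have T0 : 0 < T%:R :> R by rewrite ltr0n.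
have s0 : 0 < s by rewrite sqrtr_gt0.
have sT : s ^+ 2 = T%:R by rewrite sqr_sqrtr// ltW.
have [kf0 kg0 _ _] := A2; have [D0 _] := A1; have [e0 _ _] := A3.
split.
  have [xsf _] := xstar_opt.
  apply: le_trans (regret_bound ipxx X_fin C_closed C_convex U_dom FG_convex A1
    A2 A4 s0 x_lam_gen xsf sT) _.
  by rewrite ler_wpM2r ?(ltW s0)//; have := sqr_ge0 nug; lra.
move=> _ i.
have en := slater_le_model U_dom A3 A4 x_lam_gen i T_ge1.
have s1 : 1 <= s by rewrite -sqrtr1 ler_wsqrtr// ler1n.
have lamM := multiplier_bound ipxx X_fin C_closed C_convex U_dom FG_convex A1
  A2 A3 A4 s0 x_lam_gen.
apply: le_trans (constraint_sum_bound ipxx X_fin C_closed C_convex U_dom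
  FG_convex A1 A2 A4 s0 x_lam_gen i sT lamM) _.
have := multiplier_bound_kappa kf0 D0 e0 en s1.
have := kappa2_ge0 e0 en.
set M := (X in s * X <= _); set K := kappa0 _ _ _ + _ + _; set K2 := kappa2 _ _.
rewrite -/M => K20 sM.
have M0 : 0 <= s * M.
  by rewrite mulr_ge0 ?(ltW s0)//; exact: le_trans (enorm_ge0 _) (lamM _ (leq0n T)).
have q0 : 0 <= Num.sqrt p%:R * kg ^+ 2 by rewrite mulr_ge0 ?sqrtr_ge0 ?sqr_ge0.
have n0 := lt_le_trans e0 en.
(* Regrouping exposes the product [s M], which is bounded by [K2 + K s]. *)
rewrite (_ : s * (kg * (kf + Num.sqrt p%:R * kg * (M + nug / s))) =
  kg * kf * s + Num.sqrt p%:R * kg ^+ 2 * (s * M + nug)); last first.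
  by field; exact: lt0r_neq0.
have : Num.sqrt p%:R * kg ^+ 2 * (s * M + nug)
    <= Num.sqrt p%:R * kg ^+ 2 * (K2 + K * s + nug).
  by rewrite ler_wpM2l// lerD2r.
have : 0 <= Num.sqrt p%:R * kg ^+ 2 * (K2 + K * s + nug).
  by rewrite mulr_ge0// addr_ge0 ?(ltW n0)//; lra.
have : 0 <= kg * kf * s by rewrite !mulr_ge0 ?(ltW kg0) ?(ltW kf0) ?(ltW s0).
lra.
Qed.
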